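(* Consider two value maximizers, both with return-on-spend target $\gamma=1$, whose valuations are drawn independently from the uniform distribution $U[5/8,1]$. The optimal anonymous price is $p^\star=5/6$, and it yields expected revenue $200/243\approx 0.8230$. For the first-price auction with reserve price $r=p^\star=5/6$, there is a Bayesian Nash equilibrium whose expected revenue is approximately $0.8195$. In particular, there exists an instance with only value maximizers in which anonymous pricing extracts strictly more revenue than a (Bayesian Nash equilibrium of the) first-price auction using the optimal anonymous price as reserve.
   Context: Setting. A seller sells a single indivisible item. A value maximizer with valuation $v\sim F$ and return-on-spend (ROS) target $\gamma\ge1$ chooses a strategy $s$ (a map from valuations to bids) to maximize its expected acquired value $\mathbb{E}[v\,x(s(v))]$ subject to the ex-ante ROS constraint $\mathbb{E}[v\,x(s(v))]\ge\gamma\,\mathbb{E}[p(s(v))]$, where $x(\cdot)$ and $p(\cdot)$ are the winning probability and expected payment as functions of the bid, in expectation over the other agent's valuation under its strategy. Anonymous pricing with price $p$. The item is sold, for payment $p$, to the first arriving agent who accepts; a value maximizer accepts iff $v\ge\tau(p)$, where $\tau(p)=\inf\{\tau\in\mathrm{supp}(F):\mathbb{E}[v\mid v\ge\tau]\ge\gamma p\}$ ($\infty$ if the set is empty). The expected revenue is $p$ times the probability that at least one agent accepts; the optimal anonymous price maximizes this. First-price auction with reserve $r$. Each agent submits a bid (or abstains); the highest bid among those at least $r$ wins (ties broken arbitrarily) and the winner pays its own bid; if no bid is at least $r$ the item is not sold. A Bayesian Nash equilibrium is a strategy profile in which each agent's strategy solves its constrained maximization problem given the other's strategy. Revenue is the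 expected total payment. *)

(* Defs.v *)
From mathcomp Require Import all_boot all_order all_algebra.
From mathcomp Require Import all_classical all_reals all_analysis.
From mathcomp Require Import lra.
Set Implicit Arguments.
Unset Strict Implicit.
Unset Printing Implicit Defensive.
Import Order.TTheory GRing.Theory Num.Theory.
Import numFieldNormedType.Exports.

Local Open Scope classical_set_scope.
Local Open Scope ring_scope.

Lemma five8_lt1 (R : realType) : 5 / 8 < 1 :> R.
Proof. by lra. Qed.

Definition supp (R : realType) (F : probability (measurableTypeR R) R) : set R :=
  [set x | forall U : set R, open U -> U x -> (0 < F U)%E].

(* [tail_mean F t] is the conditional expectation of [v] given [t <= v].  If the
   conditioning event is null the quotient is [0 * +oo = 0]; this is immaterial
   below, since then almost surely no agent has a valuation above [t]. *)
Definition tail_mean (R : realType) (F : probability (measurableTypeR R) R)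
    (t : R) : \bar R :=
  (\int[F]_(v in [set v : R | (t <= v)%R]) v%:E / F [set v : R | (t <= v)%R])%E.

Definition accept_threshold (R : realType)
    (F : probability (measurableTypeR R) R) (g p : R) : \bar R :=
  ereal_inf [set t%:E | t in
    [set t : R | supp F t /\ ((g * p)%:E <= tail_mean F t)%E]].

Definition accepts (R : realType) (F : probability (measurableTypeR R) R)
    (g p v : R) : Prop :=
  (accept_threshold F g p <= v%:E)%E.

Definition pricing_revenue (R : realType)
    (F : probability (measurableTypeR R) R) (g p : R) : \bar R :=
  (p%:E * (F \x F) [set w | accepts F g p w.1 \/ accepts F g p w.2])%E.

Definition optimal_price (R : realType)
    (F : probability (measurableTypeR R) R) (g p : R) : Prop :=
  0 <= p /\
  forall p' : R, 0 <= p' -> (pricing_revenue F g p' <= pricing_revenue F g p)%E.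

(* A bid is an [option R], where [None] stands for abstaining. *)

(* [t b] is the probability that a given agent wins a tie at the bid [b]; the
   tie-breaking probability of the other agent is then [1 - t b]. *)
Definition tie_breaking (R : realType) (t : R -> R) : Prop :=
  measurable_fun setT (t : measurableTypeR R -> measurableTypeR R) /\
  forall b : R, 0 <= t b <= 1.

(* If [opp] is below the reserve it is below any eligible [own], so it needs no
   separate case. *)
Definition win (R : realType) (r : R) (t : R -> R) (own opp : option R) : R :=
  if own is Some b then
    if b < r then 0
    else if opp is Some b' then
      if b' < b then 1 else if b' == b then t b else 0
    else 1
  else 0.

Definition pay (R : realType) (r : R) (t : R -> R) (own opp : option R) : R :=
  odflt 0 own * win r t own opp.

Definition win_prob (R : realType) (F : probability (measurableTypeR R) R)
    (r : R) (t : R -> R) (sopp : R -> option R) (b : option R) : \bar R :=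
  (\int[F]_v (win r t b (sopp v))%:E)%E.

Definition exp_pay (R : realType) (F : probability (measurableTypeR R) R)
    (r : R) (t : R -> R) (sopp : R -> option R) (b : option R) : \bar R :=
  (\int[F]_v (pay r t b (sopp v))%:E)%E.

(* Measurability for the sigma-algebra of the disjoint union [R + {None}]. *)
Definition measurable_strategy (R : realType) (s : R -> option R) : Prop :=
  forall B : set (measurableTypeR R), measurable B ->
    measurable (s @^-1` (Some @` B) : set (measurableTypeR R)).

Section value_maximizer.
Variables (R : realType) (F : probability (measurableTypeR R) R) (g : R).
Variables x p : option R -> \bar R.

Definition acquired_value (s : R -> option R) : \bar R :=
  (\int[F]_v (v%:E * x (s v)))%E.

Definition ros_feasible (s : R -> option R) : Prop :=
  (g%:E * \int[F]_v p (s v) <= acquired_value s)%E.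

Definition best_response (s : R -> option R) : Prop :=
  [/\ measurable_strategy s, ros_feasible s &
      forall s' : R -> option R, measurable_strategy s' -> ros_feasible s' ->
        (acquired_value s' <= acquired_value s)%E].

End value_maximizer.

Definition fpa_BNE (R : realType) (F : probability (measurableTypeR R) R)
    (g r : R) (t : R -> R) (s1 s2 : R -> option R) : Prop :=
  let t' b := 1 - t b in
  best_response F g (win_prob F r t s2) (exp_pay F r t s2) s1 /\
  best_response F g (win_prob F r t' s1) (exp_pay F r t' s1) s2.

Definition fpa_revenue (R : realType) (F : probability (measurableTypeR R) R)
    (r : R) (t : R -> R) (s1 s2 : R -> option R) : \bar R :=
  (\int[(F \x F)%E]_w
     (pay r t (s1 w.1) (s2 w.2)
      + pay r (fun b => 1 - t b)%R (s2 w.2) (s1 w.1))%:E)%E.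

(* Main.v *)
Require Import Defs.
From mathcomp Require Import all_boot all_order all_algebra.
From mathcomp Require Import all_classical all_reals all_analysis.
From mathcomp Require Import measurable_realfun ring lra.
Import Order.TTheory GRing.Theory Num.Theory.
Import numFieldNormedType.Exports.

Set Implicit Arguments.
Unset Strict Implicit.
Unset Printing Implicit Defensive.

Local Open Scope classical_set_scope.
Local Open Scope ring_scope.

(** Pricing: for [13/16 < p < 1] the acceptance threshold is [2 p - 1], and
    [200/243] minus the revenue is [256/9 (p - 5/6)^2 (p + 1/24)]; a smaller
    price earns at most [p <= 13/16], and a price [p >= 1] is never accepted.

    Auction: by Lagrangian relaxation a value maximizer behaves like a
    quasilinear bidder of value [k v], where [k > 1].  The symmetric equilibrium
    of quasilinear bidders with values [k v] has cutoff [w = 5 / (6 k)], and [w]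
    is chosen such that the return-on-spend constraint binds.  If a feasible
    deviation acquires value [V'] for payment [P' <= V'], then the quasilinear
    optimality of the equilibrium bids gives
    [(k - 1) V' <= k V' - P' <= k V - P = (k - 1) V], whence [V' <= V].  As the
    constraint binds, the revenue is the expected value of the winner. *)

(* The cast makes [unif ab A] elaborate through the probability structure, so
   that it matches the applications [F A] occurring in the definitions. *)
Local Notation unif ab := (uniform_prob ab : probability (measurableTypeR _) _).

(** * The uniform distribution *)

(** Restricting [f] to [[a, b]] changes it only on a null set, so its sign matters only there;
    integrands such as [v * x v] may be negative for [v < 0]. *)
Lemma integral_uniform_ge0 (R : realType) (a b : R) (ab : a < b)
    (f : R -> \bar R) :
  measurable_fun [set: R] f -> (forall x, a <= x <= b -> (0 <= f x)%E) ->
  (\int[uniform_prob ab]_x f x =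
   (b - a)^-1%:E * \int[lebesgue_measure]_(x in `[a, b]) f x)%E.
Proof.
move=> mf f0; have mfr : measurable_fun [set: R] (f \_ `[a, b]).
  by apply/(measurable_restrictT _ _).1 => //; exact: measurable_funTS.
transitivity (\int[uniform_prob ab]_x (f \_ `[a, b]) x)%E.
  apply: ae_eq_integral => //.
  exists (~` `[a, b]); split; first exact: measurableC.
    transitivity (\int[lebesgue_measure]_(x in ~` `[a, b])
      (uniform_pdf a b x)%:E)%E => //.
    by rewrite integral_uniform_pdf setICl integral_set0.
  move=> x /=; apply: contra_not => xab _.
  by rewrite patchE mem_set.
rewrite integral_uniform//; last first.
  move=> x; rewrite patchE; case: ifPn => // /set_mem/=.
  by rewrite in_itv/=; exact: f0.
congr (_ * _)%E; apply: eq_integral => x xab.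
by rewrite patchE xab.
Qed.

Definition quad (R : realType) (p q r x : R) := p * x ^+ 2 + q * x + r.

Definition quad_int (R : realType) (p q r a b : R) : R :=
  p * (b ^+ 3 - a ^+ 3) / 3 + q * (b ^+ 2 - a ^+ 2) / 2 + r * (b - a).

Lemma integral_quad (R : realType) (p q r a b : R) : a <= b ->
  (\int[lebesgue_measure]_(x in `[a, b]) (quad p q r x)%:E =
   (quad_int p q r a b)%:E)%E.
Proof.
rewrite le_eqVlt => /predU1P[->|ab].
  rewrite set_itv1 integral_set1; congr EFin.
  by rewrite /quad_int !subrr !mulr0 !mul0r !addr0.
pose G : R -> R := fun x => p / 3 * x ^+ 3 + q / 2 * x ^+ 2 + r * x.
have dG (x : R) : is_derive x (1 : R) G (quad p q r x).
  apply: is_derive_eq.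
  transitivity (p / 3 * (x * (x * 1 + x * 1) + x * x * 1)
    + q / 2 * (x * 1 + x * 1) + r * 1) => //.
  by rewrite /quad; field.
rewrite (@continuous_FTC2 _ _ G)//.
- by congr EFin; rewrite /G /quad_int; ring.
- apply: derivable_within_continuous => x _.
  by apply: derivableD => //; apply: derivableD; apply: derivableM.
- have cG (x : R) : {for x, continuous G}.
    by apply: differentiable_continuous; apply/derivable1_diffP; case: (dG x).
  split.
  + by move=> x _; case: (dG x).
  + exact/cvg_at_right_filter/cG.
  + exact/cvg_at_left_filter/cG.
- by move=> x _; rewrite derive1E; case: (dG x).
Qed.

(** The common shape of the integrands below: zero under a cutoff [c], quadratic above it. *)
Lemma integral_uniform_quad (R : realType) (a b : R) (ab : a < b)
    (c p q r : R) (f : R -> R) :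
  a <= c <= b -> measurable_fun [set: R] f ->
  (forall x, a <= x < c -> f x = 0) ->
  (forall x, c <= x <= b -> f x = quad p q r x) ->
  (forall x, c <= x <= b -> 0 <= f x) ->
  (\int[uniform_prob ab]_x (f x)%:E = ((b - a)^-1 * quad_int p q r c b)%:E)%E.
Proof.
move=> /andP[ac cb] mf f_lt f_ge f_ge0.
have f0 x : a <= x <= b -> 0 <= f x.
  case/andP => ax xb; case: (ltP x c) => [xc|cx].
    by rewrite f_lt// ax.
  by rewrite f_ge0// cx.
rewrite integral_uniform_ge0//; last exact/measurable_EFinP.
rewrite EFinM; congr (_ * _)%E.
have -> : `[a, b]%classic = `[a, c[ `|` `[c, b] :> set R.
  rewrite -itv_bndbnd_setU//.
rewrite ge0_integral_setU//=.
- rewrite integral0_eq ?add0e; last first.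
    by move=> x/=; rewrite in_itv/= => xac; rewrite f_lt.
  rewrite -integral_quad//; apply: eq_integral => x.
  by rewrite inE/= in_itv/= => xcb; rewrite f_ge.
- exact/measurable_EFinP/measurable_funTS.
- move=> x /= xabc; rewrite lee_fin f0//; case: xabc; rewrite in_itv/=; lra.
- apply/disj_setPS => x /=; rewrite !in_itv/=; lra.
Qed.

Lemma uniform_prob_ge (R : realType) (a b : R) (ab : a < b) (t : R) :
  a <= t <= b ->
  unif ab [set v | t <= v] = ((b - a)^-1 * (b - t))%:E.
Proof.
move=> /andP[at_ tb].
have mA : measurable ([set v | t <= v] : set R).
  by rewrite -set_itvcy; exact: measurable_itv.
transitivity (unif ab ([set v | t <= v] `&` setT)).
  by rewrite setIT.
rewrite -integral_indic//.
rewrite (@integral_uniform_quad _ _ _ _ t 0 0 1)//.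
- by congr EFin; rewrite /quad_int; ring.
- exact/andP.
- move=> x /andP[_ xt]; rewrite indicE memNset//=.
  by apply/negP; rewrite -ltNge.
- by move=> x /andP[tx _]; rewrite indicE mem_set//= /quad; ring.
Qed.

Lemma uniform_prob_outside (R : realType) (a b : R) (ab : a < b) (A : set R) :
  measurable A -> A `&` `[a, b] = set0 -> unif ab A = 0.
Proof.
move=> mA A0; transitivity (\int[lebesgue_measure]_(x in A)
  (uniform_pdf a b x)%:E)%E => //.
by rewrite integral_uniform_pdf A0 integral_set0.
Qed.

Lemma uniform_prob_lt (R : realType) (a b : R) (ab : a < b) (c : R) :
  a <= c ->
  unif ab [set v | v < c] = (Num.min 1 ((b - a)^-1 * (c - a)))%:E.
Proof.
move=> ac; have mge : measurable ([set v | c <= v] : set (measurableTypeR R)).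
  by rewrite -set_itvcy; exact: measurable_itv.
rewrite (_ : [set v | v < c] = ~` [set v | c <= v]); last first.
  by apply/seteqP; split => v /=; rewrite ltNge => /negP.
rewrite probability_setC//.
have [cb|bc] := leP c b.
  rewrite uniform_prob_ge ?ac// -EFinB; congr EFin; rewrite min_r.
    by field; rewrite gt_eqF ?subr_gt0.
  by rewrite ler_pdivrMl ?subr_gt0// mulr1 lerB.
rewrite uniform_prob_outside//; last first.
  apply/seteqP; split => v //= [cv]; rewrite in_itv/= => /andP[_ vb].
  by have := lt_le_trans bc (le_trans cv vb); rewrite ltxx.
rewrite sube0 min_l// ler_pdivlMl ?subr_gt0// mulr1 lerB//.
exact: ltW.
Qed.

(** The integrand is the outcome of a bid that ties exactly with type [c]. Since [[set c]] is null,
    it agrees almost everywhere with the indicator of [v < c]. *)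
Lemma integral_uniform_step (R : realType) (a b : R) (ab : a < b) (c t : R) :
  a <= c ->
  (\int[uniform_prob ab]_v
     (if (v < c)%R then 1%R else if (v == c)%R then t else 0%R)%:E =
   (Num.min 1 ((b - a)^-1 * (c - a)))%:E)%E.
Proof.
move=> ac; rewrite -(uniform_prob_lt ab ac).
have mlt : measurable ([set v | v < c] : set (measurableTypeR R)).
  by rewrite -set_itvNyo; exact: measurable_itv.
transitivity (\int[uniform_prob ab]_v (\1_[set v | v < c] v)%:E)%E; last first.
  by rewrite integral_indic// setIT.
apply: ae_eq_integral => //.
- apply/measurable_EFinP; apply: measurable_fun_ifT => //.
    exact: measurable_fun_ltr.
  by apply: measurable_fun_ifT => //; exact: measurable_fun_eqr.
- exact/measurable_EFinP.
- exists [set c]; split; first exact: measurable_set1.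
    exact: (integral_set1 (fun x => (uniform_pdf a b x)%:E)).
  move=> v /=; apply: contra_notP => /eqP vc _.
  rewrite indicE (negbTE vc).
  by case: ifPn => vltc; [rewrite mem_set|rewrite memNset//=; exact/negP].
Qed.

Lemma le_integral_uniform (R : realType) (a b : R) (ab : a < b)
    (f g : R -> R) :
  measurable_fun [set: R] f -> measurable_fun [set: R] g ->
  (forall v, a <= v <= b -> 0 <= f v <= g v) ->
  (\int[uniform_prob ab]_v (f v)%:E <= \int[uniform_prob ab]_v (g v)%:E)%E.
Proof.
move=> mf mg fg.
rewrite !integral_uniform_ge0//; [|exact/measurable_EFinP| |exact/measurable_EFinP|].
- rewrite lee_pmul2l//; last by rewrite lte_fin invr_gt0 subr_gt0.
  apply: ge0_le_integral => //.
  + by move=> v/=; rewrite in_itv/= => /fg/andP[].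
  + exact/measurable_funTS/measurable_EFinP.
  + exact/measurable_funTS/measurable_EFinP.
  + by move=> v/=; rewrite in_itv/= lee_fin => /fg/andP[].
- by move=> v /fg/andP[f0 fgv]; rewrite lee_fin (le_trans f0).
- by move=> v /fg/andP[].
Qed.

(** * Anonymous pricing *)

Lemma supp_uniform_sub (R : realType) (a b : R) (ab : a < b) (x : R) :
  supp (uniform_prob ab) x -> a <= x <= b.
Proof.
move=> /(_ (~` `[a, b])); rewrite uniform_prob_outside ?setICl//; last first.
  exact: measurableC.
move=> sx; apply/negPn/negP => xab.
suff : (0 < 0 :> \bar R)%E by rewrite ltxx.
apply: sx; first by apply: closed_openC; exact: itv_closed.
by rewrite /= in_itv/=; exact/negP.
Qed.

(** If a neighbourhood [U] of [x] were null, the tails from [x] and from some [d > x] with [[x, d[]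
    inside [U] would have equal probability, whereas tail probabilities strictly decrease on
    [[a, b]]. *)
Lemma sub_supp_uniform (R : realType) (a b : R) (ab : a < b) (x : R) :
  a < x < b -> supp (uniform_prob ab) x.
Proof.
move=> /andP[ax xb] U oU Ux; rewrite lt0e measure_ge0 andbT.
apply/negP => /eqP U0.
have /nbhs_ballP[e /= e0 xeU] : nbhs x U by exact: open_nbhs_nbhs.
pose d := Num.min (x + e) b.
have [dxe db] : d <= x + e /\ d <= b by rewrite !ge_min !lexx orbT.
have xd : x < d by rewrite lt_min xb andbT ltrDl.
have mge (y : R) : measurable ([set v | y <= v] : set R).
  by rewrite -set_itvcy; exact: measurable_itv.
have mU : measurable (U : set (measurableTypeR R)) by exact: open_measurable.
have sub : [set v : R | x <= v] `<=` U `|` [set v : R | d <= v].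
  move=> v /= xv; case: (leP d v) => dv; [by right|left].
  by apply: xeU; rewrite /ball/= ltr_norml; lra.
have : (unif ab [set v | (x <= v)%R] <= unif ab [set v | (d <= v)%R])%E.
  rewrite -[leRHS]add0e -U0; apply: le_trans (measureU2 _ mU (mge d)).
  apply: le_measure; rewrite ?inE//; first exact: mge.
  by apply: measurableU => //; exact: mge.
rewrite !uniform_prob_ge ?lee_fin; [|lra..].
by rewrite ler_pM2l ?invr_gt0 ?subr_gt0//; lra.
Qed.

Lemma tail_mean_uniform (R : realType) (a b : R) (ab : a < b) (t : R) :
  0 <= a -> a <= t < b -> tail_mean (uniform_prob ab) t = ((t + b) / 2)%:E.
Proof.
move=> a0 /andP[at_ tb]; rewrite /tail_mean uniform_prob_ge ?at_ ?ltW//.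
rewrite integral_mkcond.
rewrite (_ : _ \_ _ = fun v => (if t <= v then v else 0)%:E); last first.
  apply/funext => v; rewrite patchE; case: ifPn => [/set_mem/= ->//|].
  by rewrite notin_setE/= => /negP/negbTE ->.
rewrite (@integral_uniform_quad _ _ _ _ t 0 1 0)//.
- rewrite inver mulf_eq0 invr_eq0 !subr_eq0 !gt_eqF//= -EFinM; congr EFin.
  rewrite /quad_int; field.
  by rewrite !subr_eq0 !gt_eqF.
- by rewrite at_ ltW.
- by apply: measurable_fun_ifT => //; exact: measurable_fun_ler.
- by move=> x /andP[_ xt]; rewrite leNgt xt.
- by move=> x /andP[tx _]; rewrite tx /quad; ring.
- by move=> x /andP[tx _]; rewrite tx; lra.
Qed.

(** The conditioning event is null and the quotient is 0 by convention, so the endpoint [b] never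
    meets a positive target. *)
Lemma tail_mean_uniform_max (R : realType) (a b : R) (ab : a < b) :
  tail_mean (uniform_prob ab) b = 0.
Proof.
rewrite /tail_mean null_set_integral ?mul0e//.
- by rewrite -set_itvcy; exact: measurable_itv.
- by apply: (eq_trans (uniform_prob_ge ab _)); rewrite ?lexx ?(ltW ab)// subrr mulr0.
Qed.

(** The threshold solves [(t + b) / 2 = g * p]; the bounds on [g * p] say that this solution lies
    strictly between [a] and [b], hence in the support. *)
Lemma accept_threshold_uniform (R : realType) (a b : R) (ab : a < b) (g p : R) :
  0 <= a -> (a + b) / 2 < g * p < b ->
  accept_threshold (uniform_prob ab) g p = (2 * (g * p) - b)%:E.
Proof.
move=> a0 /andP[agp gpb]; apply/eqP; rewrite eq_le; apply/andP; split.
  apply: ereal_inf_lbound; exists (2 * (g * p) - b) => //; split.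
    by apply: sub_supp_uniform; lra.
  by rewrite tail_mean_uniform ?lee_fin//; lra.
apply: le_ereal_inf_tmp => _ [t [/supp_uniform_sub/andP[at_ +] +] <-].
rewrite (le_eqVlt t) => /predU1P[->|tb].
  by rewrite tail_mean_uniform_max !lee_fin; lra.
by rewrite tail_mean_uniform ?at_// !lee_fin; lra.
Qed.

(** Tail means of types below [b] are less than [b], and the one at [b] is 0, so no type
    qualifies. *)
Lemma accept_threshold_uniform_pinfty (R : realType) (a b : R) (ab : a < b)
    (g p : R) :
  0 <= a -> b <= g * p -> accept_threshold (uniform_prob ab) g p = +oo%E.
Proof.
move=> a0 bgp; rewrite /accept_threshold (_ : [set _ | _ in _] = set0).
  exact: ereal_inf0.
apply/seteqP; split => // x [t [/supp_uniform_sub/andP[at_ tb] +] _].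
move: tb => /=.
rewrite (le_eqVlt t) => /predU1P[->|tb].
  by rewrite tail_mean_uniform_max !lee_fin; lra.
by rewrite tail_mean_uniform ?at_// lee_fin; lra.
Qed.

Lemma measurable_accepts (R : realType)
    (F : probability (measurableTypeR R) R) (g p : R) :
  measurable (accepts F g p : set (measurableTypeR R)).
Proof.
rewrite /accepts; case: (accept_threshold F g p) => [t| |].
- rewrite (_ : (fun _ => _) = [set v : R | t <= v]).
    by rewrite -set_itvcy; exact: measurable_itv.
  by apply/seteqP; split => v /=; rewrite lee_fin.
- rewrite (_ : (fun _ => _) = set0)//.
  by apply/seteqP; split => v //=; rewrite leye_eq.
- rewrite (_ : (fun _ => _) = setT)//.
  by apply/seteqP; split => v //= _; rewrite leNye.
Qed.

Lemma pricing_revenueE (R : realType)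
    (F : probability (measurableTypeR R) R) (g p m : R) :
  F (accepts F g p) = m%:E ->
  pricing_revenue F g p = (p * (1 - (1 - m) ^+ 2))%:E.
Proof.
move=> Fm; have mA := measurable_accepts F g p.
have mAc : measurable (~` accepts F g p : set (measurableTypeR R)).
  exact: measurableC.
(* Disjoint rectangles: the first agent accepts, or the first rejects and the second accepts. *)
rewrite /pricing_revenue (_ : [set _ | _] =
  (accepts F g p `*` setT) `|` (~` accepts F g p `*` accepts F g p)).
  have -> : (F \x F)%E ((accepts F g p `*` setT) `|`
      (~` accepts F g p `*` accepts F g p)) =
    ((F \x F) (accepts F g p `*` setT) +
      (F \x F) (~` accepts F g p `*` accepts F g p))%E.
    apply: measureU; [exact: measurableX..|].
    by apply/seteqP; split => // -[x y] /= [[? _] []].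
  have FAc : F (~` accepts F g p) = (1 - m)%:E by rewrite probability_setC// Fm.
  rewrite !product_measure1E// [X in (X * _ + _)%E]Fm [X in (_ + _ * X)%E]Fm.
  rewrite [X in (_ + X * _)%E]FAc [X in (_ * X + _)%E]probability_setT mule1.
  by rewrite -!EFinM; congr EFin; ring.
apply/seteqP; split => -[x y] /=.
  by have [Ax _|nAx [//|Ay]] := pselect (accepts F g p x); [left|right].
by case=> [[? _]|[_ ?]]; [left|right].
Qed.

Lemma pricing_revenue_le (R : realType)
    (F : probability (measurableTypeR R) R) (g p : R) :
  0 <= p -> (pricing_revenue F g p <= p%:E)%E.
Proof.
move=> p0; have mA := measurable_accepts F g p.
have Am := fineK (fin_num_measure F _ mA).
rewrite (pricing_revenueE (esym Am)) lee_fin ler_piMr// lerBlDr lerDl.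
exact: sqr_ge0.
Qed.

Lemma pricing_revenue_uniform (R : realType) (a b : R) (ab : a < b) (g p : R) :
  0 <= a -> (a + b) / 2 < g * p < b ->
  pricing_revenue (uniform_prob ab) g p =
    (p * (1 - (1 - (b - a)^-1 * (2 * (b - g * p))) ^+ 2))%:E.
Proof.
move=> a0 agpb; apply: pricing_revenueE.
rewrite (_ : accepts _ _ _ = [set v | 2 * (g * p) - b <= v]).
  by apply: (eq_trans (uniform_prob_ge _ _)); [lra|congr EFin; ring].
by apply/seteqP; split => v /=; rewrite /accepts accept_threshold_uniform.
Qed.

Lemma pricing_revenue_uniform0 (R : realType) (a b : R) (ab : a < b)
    (g p : R) :
  0 <= a -> b <= g * p -> pricing_revenue (uniform_prob ab) g p = 0.
Proof.
move=> a0 bgp; rewrite (@pricing_revenueE _ _ _ _ 0).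
  by congr EFin; ring.
rewrite (_ : accepts _ _ _ = set0) ?measure0//.
by apply/seteqP; split => v //=;
  rewrite /accepts accept_threshold_uniform_pinfty// leye_eq.
Qed.

Lemma pricing_revenue_56 (R : realType) :
  pricing_revenue (uniform_prob (five8_lt1 R)) 1 (5 / 6) = (200 / 243)%:E.
Proof.
rewrite pricing_revenue_uniform; [|lra..].
by congr EFin; field.
Qed.

Lemma pricing_revenue_lt (R : realType) (p : R) : 0 <= p -> p != 5 / 6 ->
  (pricing_revenue (uniform_prob (five8_lt1 R)) 1 p < (200 / 243)%:E)%E.
Proof.
(* [13/16] is the mean valuation [(5/8 + 1) / 2], beyond which the threshold formula applies; it is
   also below [200/243]. *)
move=> p0 p56; have [p1316|p1316] := leP p (13 / 16).
  by apply: le_lt_trans (pricing_revenue_le _ _ p0) _; rewrite lte_fin; lra.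
have [p1|p1] := ltP p 1; last first.
  by rewrite pricing_revenue_uniform0 ?lte_fin//; lra.
rewrite pricing_revenue_uniform; [|lra..].
rewrite lte_fin -subr_gt0 [ltRHS](_ : _ =
  256 / 9 * (p - 5 / 6) ^+ 2 * (p + 1 / 24)); last by field.
rewrite pmulr_lgt0; last lra.
by rewrite pmulr_rgt0// exprn_even_gt0//= subr_eq0.
Qed.

Lemma optimal_price_56 (R : realType) (p : R) :
  optimal_price (uniform_prob (five8_lt1 R)) 1 p <-> p = 5 / 6.
Proof.
split=> [[p0 /(_ (5 / 6))]|->].
  rewrite pricing_revenue_56 => /(_ ltac:(lra)) popt.
  apply/eqP/negPn/negP => /(pricing_revenue_lt p0).
  by rewrite ltNge popt.
split; first lra.
move=> p' p'0; rewrite pricing_revenue_56.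
have [->|p56] := eqVneq p' (5 / 6); first by rewrite pricing_revenue_56.
exact/ltW/pricing_revenue_lt.
Qed.

(** * The equilibrium bidding strategy *)

(* The factor [k] by which the relaxed problem scales valuations, expressed
   through the cutoff [w]: the lowest participating type bids its scaled
   valuation [k w], which is the reserve. *)
Definition multiplier (R : realType) (w : R) : R := 5 / 6 / w.

(* The solution of [((v - 5/8) b)' = k v] with [b w = 5/6], the first-order
   condition of a bidder of value [k v]. *)
Definition bid (R : realType) (w v : R) : R :=
  multiplier w * (5 / 8 + ((v - 5 / 8) + (w - 5 / 8) ^+ 2 / (v - 5 / 8)) / 2).

(* The larger root [u + 5/8], [u >= w - 5/8], of
   [u^2 - 2 c u + (w - 5/8)^2 = 0]. *)
Definition bid_inv (R : realType) (w b : R) : R :=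
  let c := b / multiplier w - 5 / 8 in
  5 / 8 + (c + Num.sqrt (c ^+ 2 - (w - 5 / 8) ^+ 2)).

Definition strategy (R : realType) (w v : R) : option R :=
  if w <= v then Some (bid w v) else None.

(** The uniform distribution function at the opponent type [bid_inv w b], with
    [8/3 = 1 / (1 - 5/8)]; the [min] covers bids above [bid w 1], which win surely. *)
Definition bid_prob (R : realType) (w b : R) : R :=
  if b < 5 / 6 then 0 else Num.min 1 (8 / 3 * (bid_inv w b - 5 / 8)).

(** The upper bound makes [multiplier w] exceed 1; the lower one keeps participating types away from
    the pole of [bid w] at [5/8]. *)
Definition cutoff_range (R : realType) (w : R) := 5 / 8 < w < 5 / 6.

Lemma multiplier_gt1 (R : realType) (w : R) :
  cutoff_range w -> 1 < multiplier w.
Proof.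
by case/andP => ? ?; rewrite /multiplier ltr_pdivlMr ?mul1r//; lra.
Qed.

Lemma multiplier_gt0 (R : realType) (w : R) :
  cutoff_range w -> 0 < multiplier w.
Proof. by move=> /multiplier_gt1; exact: lt_trans. Qed.

Lemma multiplierM (R : realType) (w : R) :
  cutoff_range w -> multiplier w * w = 5 / 6.
Proof. by case/andP => ? ?; rewrite /multiplier divfK// gt_eqF//; lra. Qed.

(** This factorization gives monotonicity from [w] on: there the subtracted quotient is below 1 for
    distinct arguments. *)
Lemma bid_sub (R : realType) (w x y : R) : 5 / 8 < x -> 5 / 8 < y ->
  bid w x - bid w y = multiplier w / 2 * (x - y) *
    (1 - (w - 5 / 8) ^+ 2 / ((x - 5 / 8) * (y - 5 / 8))).
Proof.
by move=> x58 y58; rewrite /bid; field; rewrite !gt_eqF//=; lra.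
Qed.

Lemma bid_cutoff (R : realType) (w : R) : cutoff_range w -> bid w w = 5 / 6.
Proof.
move=> wr; rewrite -(multiplierM wr) /bid expr2 mulfK; first by field.
by case/andP: wr => ? ?; rewrite gt_eqF ?subr_gt0.
Qed.

Lemma bid_lt (R : realType) (w x y : R) :
  cutoff_range w -> w <= x -> x < y -> bid w x < bid w y.
Proof.
move=> wr wx xy; have k0 := multiplier_gt0 wr; case/andP: wr => w58 w56.
rewrite -subr_gt0 bid_sub; [|lra..].
apply: mulr_gt0; first by apply: mulr_gt0; [exact: divr_gt0|rewrite subr_gt0].
have xy0 : 0 < (y - 5 / 8) * (x - 5 / 8) by apply: mulr_gt0; lra.
by rewrite subr_gt0 ltr_pdivrMr ?mul1r//; nra.
Qed.

Lemma bid_le (R : realType) (w x y : R) :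
  cutoff_range w -> w <= x -> x <= y -> bid w x <= bid w y.
Proof.
by move=> wr wx; rewrite le_eqVlt => /predU1P[->//|/(bid_lt wr wx)/ltW].
Qed.

Lemma bid_ge (R : realType) (w x : R) :
  cutoff_range w -> w <= x -> 5 / 6 <= bid w x.
Proof. by move=> wr wx; rewrite -(bid_cutoff wr) bid_le. Qed.

Lemma bid_inv_ge (R : realType) (w b : R) :
  cutoff_range w -> 5 / 6 <= b -> w <= bid_inv w b.
Proof.
move=> wr b56; rewrite /bid_inv; set c := _ - _.
have : w <= b / multiplier w.
  by rewrite ler_pdivlMr ?multiplier_gt0// mulrC multiplierM.
by have := sqrtr_ge0 (c ^+ 2 - (w - 5 / 8) ^+ 2); rewrite /c; lra.
Qed.

Lemma bid_invK (R : realType) (w b : R) :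
  cutoff_range w -> 5 / 6 <= b -> bid w (bid_inv w b) = b.
Proof.
move=> wr b56; have := bid_inv_ge wr b56; rewrite /bid /bid_inv.
have k0 := multiplier_gt0 wr.
have wb : w <= b / multiplier w by rewrite ler_pdivlMr// mulrC multiplierM.
case/andP: wr => w58 w56.
set c := _ - _; set s := Num.sqrt _ => ws.
have sE : s ^+ 2 = c ^+ 2 - (w - 5 / 8) ^+ 2.
  by rewrite sqr_sqrtr// /c; nra.
(* The product of the two roots: the quotient in [bid] becomes the other root [c - s], and the mean
   of the roots is [c]. *)
have -> : (w - 5 / 8) ^+ 2 = (c + s) * (c - s).
  rewrite [RHS](_ : _ = c ^+ 2 - s ^+ 2); last by ring.
  by rewrite sE; ring.
rewrite [5 / 8 + (_ + _)]addrC addrK [X in X / (c + s)]mulrC mulfK ?gt_eqF//; last lra.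
by rewrite /c; field; rewrite gt_eqF.
Qed.

(** Strict monotonicity turns the right inverse into a left inverse. *)
Lemma bidK (R : realType) (w v : R) :
  cutoff_range w -> w <= v -> bid_inv w (bid w v) = v.
Proof.
move=> wr wv; have b56 := bid_ge wr wv.
have [| |//] := ltgtP (bid_inv w (bid w v)) v.
- by move=> /(bid_lt wr (bid_inv_ge wr b56)); rewrite bid_invK ?ltxx.
- by move=> /(bid_lt wr wv); rewrite bid_invK ?ltxx.
Qed.

Lemma bid_ltE (R : realType) (w b v : R) :
  cutoff_range w -> 5 / 6 <= b -> w <= v -> (bid w v < b) = (v < bid_inv w b).
Proof.
move=> wr b56 wv; rewrite -{1}(bid_invK wr b56).
apply/idP/idP => [|/bid_lt-> //].
by apply: contraTT; rewrite -!leNgt => /(bid_le wr (bid_inv_ge wr b56)).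
Qed.

Lemma bid_eqE (R : realType) (w b v : R) :
  cutoff_range w -> 5 / 6 <= b -> w <= v -> (bid w v == b) = (v == bid_inv w b).
Proof.
by move=> wr b56 wv; apply/eqP/eqP => [<-|->]; [rewrite bidK|exact: bid_invK].
Qed.

Lemma bid_inv_le (R : realType) (w b b' : R) :
  cutoff_range w -> 5 / 6 <= b -> b <= b' -> bid_inv w b <= bid_inv w b'.
Proof.
move=> wr b56 bb'; have b'56 : 5 / 6 <= b' by exact: le_trans bb'.
rewrite leNgt; apply/negP => /(bid_lt wr (bid_inv_ge wr b'56)).
by rewrite !bid_invK// ltNge bb'.
Qed.

(** An abstaining opponent has type [v < w <= bid_inv w b], so it is covered by the same comparison
    of types as a bidding one. *)
Lemma win_strategy (R : realType) (w : R) (t : R -> R) (b v : R) :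
  cutoff_range w -> win (5 / 6) t (Some b) (strategy w v) =
  if b < 5 / 6 then 0 else
  if v < bid_inv w b then 1 else if v == bid_inv w b then t b else 0.
Proof.
move=> wr; rewrite /win /strategy; case: ltP => // b56.
case: ifPn => [wv|]; first by rewrite bid_ltE// bid_eqE.
by rewrite -ltNge => vw; rewrite (lt_le_trans vw (bid_inv_ge wr b56)).
Qed.

Lemma bid_prob_itv (R : realType) (w b : R) :
  cutoff_range w -> 0 <= bid_prob w b <= 1.
Proof.
move=> wr; rewrite /bid_prob; case: ltP => [_|/(bid_inv_ge wr) b56].
  by rewrite lexx ler01.
case/andP: wr => w58 w56.
by rewrite le_min ge_min lexx ler01 mulr_ge0//; lra.
Qed.

Lemma bid_prob_nondecreasing (R : realType) (w : R) :
  cutoff_range w -> {homo bid_prob w : b b' / b <= b'}.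
Proof.
move=> wr b b' bb'; have /andP[b'0 _] := bid_prob_itv b' wr.
have [b56|b56] := ltP b (5 / 6); first by rewrite {1}/bid_prob b56.
rewrite /bid_prob !ltNge b56 (le_trans b56 bb')/=.
rewrite le_min ge_min lexx ge_min/= ler_pM2l; last lra.
by rewrite lerB ?bid_inv_le ?orbT.
Qed.

Lemma measurable_bid_prob (R : realType) (w : R) :
  cutoff_range w -> measurable_fun [set: R] (bid_prob w).
Proof.
by move=> wr; apply: nondecreasing_measurable => //; exact: bid_prob_nondecreasing.
Qed.

Lemma bid_prob_bid (R : realType) (w v : R) : cutoff_range w ->
  w <= v <= 1 -> bid_prob w (bid w v) = 8 / 3 * (v - 5 / 8).
Proof.
move=> wr /andP[wv v1]; rewrite /bid_prob ltNge bid_ge//= bidK//.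
by apply/min_r; lra.
Qed.

(** [bid w] decreases between [5/8] and [w]; freezing it below [w] makes it monotone on the whole
    line, hence measurable. *)
Lemma measurable_bid (R : realType) (w : R) :
  cutoff_range w -> measurable_fun [set: R] (fun v => bid w (Num.max w v)).
Proof.
move=> wr; apply: nondecreasing_measurable => // x y xy; apply: bid_le => //.
  by rewrite le_max lexx.
by rewrite ge_max !le_max lexx xy orbT.
Qed.

Lemma measurable_strategy_strategy (R : realType) (w : R) :
  cutoff_range w -> measurable_strategy (strategy w).
Proof.
move=> wr B mB; rewrite (_ : _ @^-1` _ =
    `[w, +oo[ `&` (fun v => bid w (Num.max w v)) @^-1` B).
  apply: measurableI => //; rewrite -[X in measurable X]setTI.
  exact: measurable_bid.
apply/seteqP; split => v /=; rewrite in_itv/= andbT /strategy.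
  by case: ifPn => [wv [y By [yE]]|_ [y _ //]]; rewrite max_r// -yE.
by move=> [wv]; rewrite wv max_r//; exists (bid w v).
Qed.

Lemma win_prob_strategy (R : realType) (w : R) (t : R -> R) :
  cutoff_range w ->
  win_prob (uniform_prob (five8_lt1 R)) (5 / 6) t (strategy w) =
  fun b => (oapp (bid_prob w) 0 b)%:E.
Proof.
move=> wr; apply/funext => -[b|]; rewrite /win_prob/=; last exact: integral0.
under eq_integral do rewrite -[if _ then _ else _]/(win _ _ (Some b) _) win_strategy//.
rewrite /bid_prob; case: ltP => b56; first exact: integral0.
rewrite integral_uniform_step//.
  by congr (Num.min _ _)%:E; field.
by have := bid_inv_ge wr b56; case/andP: wr => w58 _; apply: le_trans; exact: ltW.
Qed.

Lemma exp_pay_strategy (R : realType) (w : R) (t : R -> R) :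
  cutoff_range w -> (forall b, 0 <= t b) ->
  exp_pay (uniform_prob (five8_lt1 R)) (5 / 6) t (strategy w) =
  fun b => (oapp (fun b => b * bid_prob w b) 0 b)%:E.
Proof.
move=> wr t0; apply/funext => -[b|]; last first.
  rewrite /exp_pay -[RHS](integral0 (uniform_prob (five8_lt1 R)) setT).
  by apply: eq_integral => v _; rewrite /pay/= mul0r.
have wE := congr1 (@^~ (Some b)) (win_prob_strategy t wr).
rewrite /exp_pay /= EFinM -wE /win_prob.
(* A bid below the reserve may be negative, so it is not pulled out of the integral as a factor;
   both integrands vanish instead. *)
have [b56|b56] := ltP b (5 / 6).
  rewrite !integral0_eq ?mule0// => v _; first by rewrite win_strategy// b56.
  by rewrite /pay win_strategy// b56 mulr0.
rewrite -ge0_integralZl//.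
- apply/measurable_EFinP; under eq_fun do rewrite win_strategy// ltNge b56/=.
  apply: measurable_fun_ifT => //; first exact: measurable_fun_ltr.
  by apply: measurable_fun_ifT => //; exact: measurable_fun_eqr.
- move=> v _; rewrite lee_fin win_strategy// ltNge b56/=.
  by case: (v < _) => //; case: (v == _).
- by rewrite lee_fin; lra.
Qed.

Lemma measurable_oapp_strategy (R : realType) (h : R -> R) (s : R -> option R) :
  measurable_fun [set: R] h -> measurable_strategy s ->
  measurable_fun [set: R] (fun v => oapp h 0 (s v)).
Proof.
move=> mh ms _ B mB; rewrite setTI (_ : _ @^-1` _ =
    s @^-1` (Some @` (h @^-1` B)) `|`
    (~` (s @^-1` (Some @` setT)) `&` [set _ | B 0])).
  apply: measurableU.
    by apply: ms; rewrite -[X in measurable X]setTI; exact: mh.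
  apply: measurableI; first by apply: measurableC; exact: ms.
  have [B0|B0] := pselect (B 0).
    by rewrite (_ : [set _ | _] = setT)//; apply/seteqP; split.
  by rewrite (_ : [set _ | _] = set0)//; apply/seteqP; split.
apply/seteqP; split => v /=.
  case: (s v) => [b|] /= Bh; [by left; exists b|right; split => //].
  by case.
by case=> [[b Bb <-//]|[]]; case: (s v) => [b []|//]; exists b.
Qed.

(** * Best responses and revenue *)

(* The cubic is, up to a factor nonzero on the cutoff range, the difference of the
   expected value and the expected payment under [strategy w]. *)
Definition ros_binding (R : realType) (w : R) :=
  48 * w ^+ 3 - 77 * w ^+ 2 + 58 * w - 20 = 0.

(** The expected value acquired by one agent: the integrand is [8/3 * v * (v - 5/8)] on [[w, 1]]. *)
Definition strategy_value (R : realType) (w : R) : R :=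
  (1 - 5 / 8)^-1 * quad_int (8 / 3) (- (5 / 3)) 0 w 1.

(* The equilibrium utility of a quasilinear bidder of value [multiplier w * v]. *)
Definition virtual_utility (R : realType) (w v : R) : R :=
  if w <= v then 4 / 3 * multiplier w * ((v - 5 / 8) ^+ 2 - (w - 5 / 8) ^+ 2)
  else 0.

Lemma measurable_bid_pay (R : realType) (w : R) : cutoff_range w ->
  measurable_fun [set: R] (fun b => b * bid_prob w b).
Proof. by move=> wr; apply: measurable_funM => //; exact: measurable_bid_prob. Qed.

Lemma measurable_virtual_utility (R : realType) (w : R) :
  measurable_fun [set: R] (virtual_utility w).
Proof.
apply: measurable_fun_ifT => //; first exact: measurable_fun_ler.
apply: measurable_funM => //; apply: measurable_funB => //.
by apply: measurable_funX; exact: measurable_funB.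
Qed.

Lemma virtual_utility_ge0 (R : realType) (w v : R) :
  cutoff_range w -> 0 <= virtual_utility w v.
Proof.
move=> wr; have k0 := multiplier_gt0 wr; case/andP: wr => w58 w56.
rewrite /virtual_utility; case: (leP w v) => // wv.
by apply: mulr_ge0; [apply: mulr_ge0; lra|nra].
Qed.

Lemma strategy_value_integral (R : realType) (w : R) : cutoff_range w ->
  (\int[uniform_prob (five8_lt1 R)]_v
     (v * oapp (bid_prob w) 0 (strategy w v))%:E = (strategy_value w)%:E)%E.
Proof.
move=> wr; rewrite (@integral_uniform_quad _ _ _ _ w (8 / 3) (- (5 / 3)) 0)//.
- by case/andP: wr => ? ?; lra.
- apply: measurable_funM => //; apply: measurable_oapp_strategy.
    exact: measurable_bid_prob.
  exact: measurable_strategy_strategy.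
- by move=> x /andP[_ xw]; rewrite /strategy leNgt xw/= mulr0.
- move=> x /andP[wx x1]; rewrite /strategy wx/= bid_prob_bid ?wx// /quad.
  by field.
- move=> x /andP[wx x1]; rewrite /strategy wx/= bid_prob_bid ?wx//.
  by case/andP: wr => ? ?; apply: mulr_ge0; lra.
Qed.

Lemma strategy_pay_integral (R : realType) (w : R) :
  cutoff_range w -> ros_binding w ->
  (\int[uniform_prob (five8_lt1 R)]_v
     (oapp (fun b => b * bid_prob w b) 0 (strategy w v))%:E
   = (strategy_value w)%:E)%E.
Proof.
move=> wr wbind; have /andP[w58 w56] := wr; have k0 := multiplier_gt0 wr.
(* The winning probability is proportional to [v - 5/8], which clears the denominator of [bid] and
   leaves a quadratic. *)
rewrite (@integral_uniform_quad _ _ _ _ w (4 / 3 * multiplier w) 0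
  (4 / 3 * multiplier w * ((w - 5 / 8) ^+ 2 - (5 / 8) ^+ 2)))//.
- congr EFin; apply/eqP; rewrite eq_sym -subr_eq0; apply/eqP.
  transitivity (4 / 81 * (1 - w) / w *
    (48 * w ^+ 3 - 77 * w ^+ 2 + 58 * w - 20)); last by rewrite wbind mulr0.
  rewrite /strategy_value /quad_int /multiplier; field.
  by rewrite gt_eqF//; lra.
- by lra.
- apply: measurable_oapp_strategy; first exact: measurable_bid_pay.
  exact: measurable_strategy_strategy.
- by move=> x /andP[_ xw]; rewrite /strategy leNgt xw.
- move=> x /andP[wx x1]; rewrite /strategy wx/= bid_prob_bid ?wx// /quad /bid.
  by field; rewrite gt_eqF//; lra.
- move=> x /andP[wx x1]; rewrite /strategy wx/= bid_prob_bid ?wx//.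
  by have := bid_ge wr wx => ?; apply: mulr_ge0; lra.
Qed.

(** With [k = multiplier w], the utility on path is [k v x - p]; it integrates to [k V - P], and
    [P = V] when the constraint binds. *)
Lemma virtual_utility_integral (R : realType) (w : R) :
  cutoff_range w -> ros_binding w ->
  (\int[uniform_prob (five8_lt1 R)]_v (virtual_utility w v)%:E =
   ((multiplier w - 1) * strategy_value w)%:E)%E.
Proof.
move=> wr wbind; have /andP[w58 w56] := wr.
rewrite (@integral_uniform_quad _ _ _ _ w (4 / 3 * multiplier w)
  (- (5 / 3 * multiplier w))
  (4 / 3 * multiplier w * ((5 / 8) ^+ 2 - (w - 5 / 8) ^+ 2)))//.
- congr EFin; apply/eqP; rewrite eq_sym -subr_eq0; apply/eqP.
  transitivity (- (4 / 81 * (1 - w) / w *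
    (48 * w ^+ 3 - 77 * w ^+ 2 + 58 * w - 20))).
    rewrite /strategy_value /quad_int /multiplier; field.
    by rewrite gt_eqF//; lra.
  by rewrite wbind mulr0 oppr0.
- by lra.
- exact: measurable_virtual_utility.
- by move=> x /andP[_ xw]; rewrite /virtual_utility leNgt xw.
- by move=> x /andP[wx x1]; rewrite /virtual_utility wx /quad; field.
- by move=> x _; exact: virtual_utility_ge0.
Qed.

(** An eligible bid imitates some type [y >= w]. The resulting utility is a concave quadratic in [y]
    peaking at [y = v], so participating types do best by their own bid and types below [w] by
    abstaining. *)
Lemma virtual_utility_opt (R : realType) (w v : R) (b : option R) :
  cutoff_range w -> 5 / 8 <= v <= 1 ->
  multiplier w * (v * oapp (bid_prob w) 0 b) <=
  oapp (fun b => b * bid_prob w b) 0 b + virtual_utility w v.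
Proof.
move=> wr /andP[v58 v1]; have u0 := virtual_utility_ge0 v wr.
case: b => [b|] /=; last by rewrite !mulr0 add0r.
have [b56|b56] := ltP b (5 / 6); first by rewrite /bid_prob b56 !mulr0 add0r.
have ub_bid (y : R) : w <= y -> (multiplier w * v - bid w y) * (8 / 3 * (y - 5 / 8))
    <= virtual_utility w v.
  move=> wy; have k0 := multiplier_gt0 wr; have /andP[w58 w56] := wr.
  rewrite [leLHS](_ : _ = 4 / 3 * multiplier w *
    (2 * (v - 5 / 8) * (y - 5 / 8) - (y - 5 / 8) ^+ 2 - (w - 5 / 8) ^+ 2)).
    rewrite /virtual_utility; case: (leP w v) => wv.
      rewrite ler_pM2l; last lra.
      by have := sqr_ge0 (v - y); rewrite !expr2; lra.
    (* For [v < w] the bracket equals [- (w - y)^2 - 2 (w - v) (y - 5/8)]. *)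
    rewrite pmulr_rle0; last lra.
    have wy0 := sqr_ge0 (w - y).
    have : 0 <= (w - v) * (y - 5 / 8) by apply: mulr_ge0; lra.
    by move: wy0; rewrite !expr2; lra.
  by rewrite /bid; field; rewrite gt_eqF//; lra.
have wi := bid_inv_ge wr b56.
suff : (multiplier w * v - b) * bid_prob w b <= virtual_utility w v by lra.
rewrite /bid_prob ltNge b56/=.
have [i1|i1] := leP (bid_inv w b) 1.
  rewrite min_r; last lra.
  by rewrite -{1}(bid_invK wr b56); exact: ub_bid.
(* Such a bid wins surely, as [bid w 1] already does at no higher price. *)
rewrite min_l; last lra.
have w1 : w <= 1 by case/andP: wr; lra.
have := ub_bid _ w1; apply: le_trans.
have : bid w 1 <= b by rewrite -(bid_invK wr b56) bid_le// ltW.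
lra.
Qed.

Lemma best_response_strategy (R : realType) (w : R) (t : R -> R) :
  cutoff_range w -> ros_binding w -> (forall b, 0 <= t b) ->
  let F := uniform_prob (five8_lt1 R) in
  best_response F 1 (win_prob F (5 / 6) t (strategy w))
    (exp_pay F (5 / 6) t (strategy w)) (strategy w).
Proof.
move=> wr wbind t0 F; rewrite win_prob_strategy// exp_pay_strategy//.
have k1 := multiplier_gt1 wr; have k0 := multiplier_gt0 wr.
have mst := measurable_strategy_strategy wr.
split => //.
  rewrite /ros_feasible /acquired_value mul1e strategy_pay_integral//.
  by rewrite [leRHS](strategy_value_integral wr).
move=> s ms; rewrite /ros_feasible /acquired_value mul1e.
rewrite [X in (_ -> _ <= X)%E](strategy_value_integral wr).
pose P := (\int[F]_v (oapp (fun b => b * bid_prob w b) 0 (s v))%:E)%E.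
pose V := (\int[F]_v (v * oapp (bid_prob w) 0 (s v))%:E)%E.
rewrite -[X in (X <= _ -> _)%E]/P -[X in (_ <= X -> _)%E]/V.
rewrite -[X in (_ -> X <= _)%E]/V => PV.
have mx := measurable_oapp_strategy (measurable_bid_prob wr) ms.
have mp := measurable_oapp_strategy (measurable_bid_pay wr) ms.
have mu := measurable_virtual_utility w.
have x01 v : 0 <= oapp (bid_prob w) 0 (s v) <= 1.
  by case: (s v) => [b|]/=; [exact: bid_prob_itv|rewrite lexx ler01].
have p0 v : 0 <= oapp (fun b => b * bid_prob w b) 0 (s v).
  case: (s v) => //= b; rewrite /bid_prob; case: ltP => b56; first by rewrite mulr0.
  have := bid_prob_itv b wr; rewrite /bid_prob ltNge b56/= => /andP[x0 _].
  by rewrite mulr_ge0//; lra.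
have mvx : measurable_fun [set: R] (fun v => v * oapp (bid_prob w) 0 (s v)).
  exact: measurable_funM.
have P0 : (0 <= P)%E by apply: integral_ge0 => v _; rewrite lee_fin.
(* This bound makes [V], and with it [P <= V], finite, so that the final inequality can be
   rearranged in the reals. *)
have V1 : (V <= 1)%E.
  rewrite -[leRHS](@probability_setT _ _ _ (unif (five8_lt1 R))).
  rewrite -[leRHS]mul1e -integral_cst//.
  apply: le_integral_uniform => // v v01; have := x01 v; nra.
(* The pointwise bound [virtual_utility_opt], integrated over the types. *)
have VU : (V <= (multiplier w)^-1%:E *
    (P + ((multiplier w - 1) * strategy_value w)%:E))%E.
  rewrite -virtual_utility_integral// -ge0_integralD//=.
  - rewrite -ge0_integralZl//.
    + under [leRHS]eq_integral do rewrite -EFinD -EFinM.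
      apply: le_integral_uniform => //.
        by apply: measurable_funM => //; exact: measurable_funD.
      move=> v v01; apply/andP; split; first by have := x01 v; nra.
      by rewrite ler_pdivlMl//; exact: virtual_utility_opt.
    + by apply/measurable_EFinP; exact: measurable_funD.
    + by move=> v _; rewrite adde_ge0// lee_fin ?virtual_utility_ge0.
    + by rewrite lee_fin invr_ge0 ltW.
  - by move=> v _; rewrite lee_fin.
  - exact/measurable_EFinP.
  - by move=> v _; rewrite lee_fin virtual_utility_ge0.
  - exact/measurable_EFinP.
have Vfin : V \is a fin_num.
  by rewrite ge0_fin_numE ?(le_lt_trans V1) ?ltry// (le_trans P0).
have Pfin : P \is a fin_num.
  by rewrite ge0_fin_numE// (le_lt_trans (le_trans PV V1)) ?ltry.
move: PV VU; rewrite -(fineK Vfin) -(fineK Pfin) -EFinD -EFinM !lee_fin.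
rewrite ler_pdivlMl// => PV VU.
suff : (multiplier w - 1) * fine V <= (multiplier w - 1) * strategy_value w.
  by rewrite ler_pM2l// subr_gt0.
lra.
Qed.

(** * Expected revenue in equilibrium *)

Lemma pay_strategy (R : realType) (w : R) (t : R -> R) (x y : R) :
  cutoff_range w ->
  pay (5 / 6) t (strategy w x) (strategy w y) =
  if w <= x then
    bid w (Num.max w x) *
    (if y < x then 1 else if y == x then t (bid w (Num.max w x)) else 0)
  else 0.
Proof.
move=> wr; rewrite /pay [strategy w x]/strategy; case: (leP w x) => wx; last exact: mul0r.
by rewrite win_strategy// ltNge bid_ge//= bidK.
Qed.

Lemma pay_strategy_ge0 (R : realType) (w : R) (t : R -> R) (x y : R) :
  cutoff_range w -> (forall b, 0 <= t b) ->
  0 <= pay (5 / 6) t (strategy w x) (strategy w y).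
Proof.
move=> wr t0; rewrite pay_strategy//; case: (leP w x) => // wx.
apply: mulr_ge0; last by case: (y < x) => //; case: (y == x).
by have := bid_ge wr wx; lra.
Qed.

(** General [f] and [g] let either projection of the pair of valuations play the bidder. *)
Lemma measurable_pay_strategy (R : realType) (w : R) (t : R -> R) d
    (T : measurableType d) (f g : T -> measurableTypeR R) :
  cutoff_range w ->
  measurable_fun setT (t : measurableTypeR R -> measurableTypeR R) ->
  measurable_fun setT f -> measurable_fun setT g ->
  measurable_fun [set: T]
    (fun z => pay (5 / 6) t (strategy w (f z)) (strategy w (g z))).
Proof.
move=> wr mt mf mg; under eq_fun do rewrite pay_strategy//.
have mb : measurable_fun setT (fun z => bid w (Num.max w (f z))).
  exact: (measurableT_comp (measurable_bid wr)).
apply: measurable_fun_ifT => //; first exact: measurable_fun_ler.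
apply: measurable_funM => //.
apply: measurable_fun_ifT => //; first exact: measurable_fun_ltr.
apply: measurable_fun_ifT => //; first exact: measurable_fun_eqr.
exact: (measurableT_comp mt).
Qed.

Lemma fpa_revenue_strategy (R : realType) (w : R) (t : R -> R) :
  cutoff_range w -> ros_binding w -> tie_breaking t ->
  fpa_revenue (uniform_prob (five8_lt1 R)) (5 / 6) t (strategy w) (strategy w) =
    (2 * strategy_value w)%:E.
Proof.
move=> wr wbind [mt t01]; set F := (uniform_prob _ : probability _ _).
pose t' b := 1 - t b.
have mt' : measurable_fun setT (t' : measurableTypeR R -> measurableTypeR R).
  exact: measurable_funB.
have t0 b : 0 <= t b by case/andP: (t01 b).
have t'0 b : 0 <= t' b by rewrite subr_ge0; case/andP: (t01 b).
(* Stated for any nonnegative tie rule, so as to serve both [t] and [1 - t]. *)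
have revE (u : R -> R) : (forall b, 0 <= u b) ->
    (\int[F]_x \int[F]_y (pay (5 / 6) u (strategy w x) (strategy w y))%:E =
     (strategy_value w)%:E)%E.
  move=> u0; rewrite -(strategy_pay_integral wr wbind).
  apply: eq_integral => x _.
  by have := congr1 (@^~ (strategy w x)) (exp_pay_strategy wr u0).
rewrite /fpa_revenue; under eq_integral do rewrite EFinD.
rewrite ge0_integralD//=; first last.
- apply/measurable_EFinP; exact: measurable_pay_strategy.
- by move=> z _; rewrite lee_fin pay_strategy_ge0.
- apply/measurable_EFinP; exact: measurable_pay_strategy.
- by move=> z _; rewrite lee_fin pay_strategy_ge0.
(* The two payments are integrated in opposite orders, each with the opponent's valuation
   innermost. *)
rewrite fubini_tonelli1; first last.
- by move=> z; rewrite lee_fin pay_strategy_ge0.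
- apply/measurable_EFinP; exact: measurable_pay_strategy.
rewrite fubini_tonelli2; first last.
- by move=> z; rewrite lee_fin pay_strategy_ge0.
- apply/measurable_EFinP; exact: measurable_pay_strategy.
rewrite /fubini_F /fubini_G/= (revE t t0) (revE t' t'0).
by rewrite -EFinD; congr EFin; ring.
Qed.

(** * Numerical location of the cutoff and of the revenue *)

Lemma ros_binding_root (R : realType) : exists2 w : R,
  73 / 100 + 916 / 1000 / 1000 <= w <= 73 / 100 + 917 / 1000 / 1000 & ros_binding w.
Proof.
pose P : {poly R} := 48 *: 'X^3 - 77 *: 'X^2 + 58 *: 'X - 20%:P.
have PE x : P.[x] = 48 * x ^+ 3 - 77 * x ^+ 2 + 58 * x - 20.
  by rewrite /P !hornerE.
(* The cubic changes sign between these two points. *)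
have [] := @poly_ivt _ P
  (73 / 100 + 916 / 1000 / 1000) (73 / 100 + 917 / 1000 / 1000).
- lra.
- by rewrite !PE; lra.
by move=> w wi /rootP; rewrite PE; exists w.
Qed.

Lemma strategy_value_approx (R : realType) (w : R) :
  73 / 100 + 916 / 1000 / 1000 <= w <= 73 / 100 + 917 / 1000 / 1000 ->
  `|2 * strategy_value w - 1639 / 2000| <= 5 / 10 ^+ 5.
Proof.
move=> /andP[lw uw]; set l := 73 / 100 + _ in lw; set u := 73 / 100 + _ in uw.
have l0 : 0 <= l by rewrite /l; lra.
have w0 : 0 <= w by exact: le_trans lw.
(* The value is affine in [w ^+ 2] and [w ^+ 3], so bracketing each power separately leaves a linear
   problem. *)
have : l ^+ 2 <= w ^+ 2 <= u ^+ 2 by rewrite !lerXn2r ?nnegrE// (le_trans w0).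
have : l ^+ 3 <= w ^+ 3 <= u ^+ 3 by rewrite !lerXn2r ?nnegrE// (le_trans w0).
rewrite /l /u ler_norml /strategy_value /quad_int.
by rewrite (_ : (1 - 5 / 8)^-1 = 8 / 3); [lra|field].
Qed.

Theorem mainTheorem5 (R : realType) :
  let F := uniform_prob (five8_lt1 R) in
  [/\ (forall p : R, optimal_price F 1 p <-> p = 5 / 6)
        /\ pricing_revenue F 1 (5 / 6) = (200 / 243)%:E
        /\ `|200 / 243 - 823 / 1000 : R| <= 5 / 10 ^+ 5,
      forall t : R -> R, tie_breaking t ->
        exists s1 s2 : R -> option R,
          fpa_BNE F 1 (5 / 6) t s1 s2 /\
          exists rev : R, fpa_revenue F (5 / 6) t s1 s2 = rev%:E /\
            `|rev - 1639 / 2000| <= 5 / 10 ^+ 5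
    & exists (G : probability (measurableTypeR R) R) (g p : R),
        [/\ G [set v : R | v < 0] = 0%E,
            1 <= g,
            (forall p' : R, optimal_price G g p' <-> p' = p)
          & forall t : R -> R, tie_breaking t ->
              exists s1 s2 : R -> option R,
                fpa_BNE G g p t s1 s2 /\
                (fpa_revenue G p t s1 s2 < pricing_revenue G g p)%E]].
Proof.
have [w w_itv wbind] := ros_binding_root R.
have wr : cutoff_range w by case/andP: w_itv => ? ?; apply/andP; lra.
have eqm t : tie_breaking t ->
    fpa_BNE (uniform_prob (five8_lt1 R)) 1 (5 / 6) t (strategy w) (strategy w).
  move=> [_ t01]; split; apply: best_response_strategy => // b.
    by case/andP: (t01 b).
  by rewrite subr_ge0; case/andP: (t01 b).
have vw := strategy_value_approx w_itv.
move=> F; split.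
- split; first exact: optimal_price_56.
  split; first exact: pricing_revenue_56.
  by rewrite ler_norml; lra.
- move=> t tb; exists (strategy w), (strategy w); split; first exact: eqm.
  by exists (2 * strategy_value w); rewrite fpa_revenue_strategy.
- exists F, 1, (5 / 6); split => //.
  + apply: uniform_prob_outside.
      by rewrite -set_itvNyo; exact: measurable_itv.
    by apply/seteqP; split => v //=; rewrite in_itv/=; lra.
  + exact: optimal_price_56.
  + move=> t tb; exists (strategy w), (strategy w); split; first exact: eqm.
    (* The auction earns at most [0.8195 + 0.00005], while [200/243 > 0.823]. *)
    rewrite fpa_revenue_strategy// pricing_revenue_56 lte_fin.
    by move: vw; rewrite ler_norml; lra.
Qed.
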